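(* Let $n,N,m,r$ be natural numbers with $1\le r\le n$ and let $\mathcal{X}:\mathbb{R}^{n\times N}\to\mathbb{R}^m$ be a linear map which has the rank-$2r$ Restricted Isometry Property with a constant $\delta_{2r}<1/3$. Then $\mathcal{X}$ has the rank-$r$ Null Space Property. In particular, every $A\in\mathbb{R}^{n\times N}$ with $\mathrm{rank}(A)\le r$ is the unique minimizer of $$\min_{Z\in\mathbb{R}^{n\times N}}\|Z\|_*\quad\text{subject to}\quad\mathcal{X}(Z)=\mathcal{X}(A).$$
   Context: For $M\in\mathbb{R}^{n\times N}$, $\sigma_1(M)\ge\dots\ge\sigma_n(M)\ge0$ denote the singular values of $M$ (square roots of the eigenvalues of $MM^T$), $\|M\|_*=\sum_j\sigma_j(M)$ is the nuclear norm and $\|M\|_F$ the Frobenius norm. A linear map $\mathcal{X}:\mathbb{R}^{n\times N}\to\mathbb{R}^m$ has the rank-$k$ Restricted Isometry Property with constant $\delta_k>0$ if $(1-\delta_k)\|A\|_F^2\le\|\mathcal{X}(A)\|_2^2\le(1+\delta_k)\|A\|_F^2$ for all $A\in\mathbb{R}^{n\times N}$ of rank at most $k$. $\mathcal{X}$ has the rank-$r$ Null Space Property if $\sum_{j=1}^r\sigma_j(M)<\sum_{j=r+1}^n\sigma_j(M)$ for all $M\in\ker\mathcal{X}\setminus\{0\}$. *)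

(* Defs.v *)
From HB Require Import structures.
From mathcomp Require Import all_boot all_order all_algebra.
From mathcomp Require Import polyrcf.
From mathcomp Require Import reals.

Set Implicit Arguments.
Unset Strict Implicit.
Unset Printing Implicit Defensive.

Import Order.TTheory GRing.Theory Num.Theory.

Local Open Scope ring_scope.

(* Algebraic multiplicities; only the eigenvalues lying in R are listed, which
   for the symmetric matrices M *m M^T used below is all of them. *)
Definition eigenvalues (R : realType) (n : nat) (A : 'M[R]_n) : seq R :=
  sort >=%R (flatten [seq nseq (mup x (char_poly A)) x
                     | x <- rootsR (char_poly A)]).

Definition singular_values (R : realType) (n N : nat) (M : 'M[R]_(n, N)) :
    seq R :=
  [seq Num.sqrt x | x <- eigenvalues (M *m M^T)].

(* Indexed from 1: the singular values of M are sigma M 1, ..., sigma M n. *)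
Definition sigma (R : realType) (n N : nat) (M : 'M[R]_(n, N)) (j : nat) : R :=
  (singular_values M)`_j.-1.

Definition nuclear_norm (R : realType) (n N : nat) (M : 'M[R]_(n, N)) : R :=
  \sum_(1 <= j < n.+1) sigma M j.

Definition frobenius_norm (R : realType) (n N : nat) (M : 'M[R]_(n, N)) : R :=
  Num.sqrt (\sum_(i < n) \sum_(j < N) M i j ^+ 2).

Definition l2_norm (R : realType) (m : nat) (v : 'cV[R]_m) : R :=
  Num.sqrt (\sum_(i < m) v i 0 ^+ 2).

Definition has_RIP (R : realType) (n N m : nat)
    (X : {linear 'M[R]_(n, N) -> 'cV[R]_m}) (k : nat) (delta : R) : Prop :=
  0 < delta /\
  forall A : 'M[R]_(n, N), (\rank A <= k)%N ->
    (1 - delta) * frobenius_norm A ^+ 2 <= l2_norm (X A) ^+ 2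
      <= (1 + delta) * frobenius_norm A ^+ 2.

Definition has_NSP (R : realType) (n N m : nat)
    (X : {linear 'M[R]_(n, N) -> 'cV[R]_m}) (r : nat) : Prop :=
  forall M : 'M[R]_(n, N), X M = 0 -> M != 0 ->
    \sum_(1 <= j < r.+1) sigma M j < \sum_(r.+1 <= j < n.+1) sigma M j.

Definition is_minimizer (R : realType) (T : Type) (f : T -> R)
    (feasible : T -> Prop) (a : T) : Prop :=
  feasible a /\ forall z : T, feasible z -> f a <= f z.

Definition is_unique_minimizer (R : realType) (T : Type) (f : T -> R)
    (feasible : T -> Prop) (a : T) : Prop :=
  is_minimizer f feasible a /\
  forall z : T, is_minimizer f feasible z -> z = a.

(* Main.v *)
Require Import Defs.
From HB Require Import structures.
From mathcomp Require Import all_boot all_order all_algebra.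
From mathcomp Require Import perm spectral.
From mathcomp Require Import polyrcf complex.
From mathcomp Require Import reals.
From mathcomp Require Import ring lra.

Set Implicit Arguments.
Unset Strict Implicit.
Unset Printing Implicit Defensive.

Import Order.TTheory GRing.Theory Num.Theory.

Local Open Scope ring_scope.

(** Null Space Property.  Cut the singular value decomposition of M in ker X
    into consecutive blocks M_0, M_1, ... of r singular values.  Polarizing the
    RIP on rank-2r matrices gives, in Frobenius norms,
    |<X M_0, X M_k>| <= delta |M_0| |M_k| for k > 0, so X M = 0 yields
    (1 - delta) |M_0| <= delta (|M_1| + |M_2| + ...).
    Since sqrt r |M_(k+1)| is at most the sum b_k of the k-th block, and
    b_0 <= sqrt r |M_0|, this reads (1 - delta) b_0 <= delta |M|_*, whence
    b_0 < |M|_* / 2 as delta < 1/3.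

    Unique recovery.  For rank A <= r we need
    |A + M|_* >= |A|_* + sum_(j>r) sigma_j(M) - sum_(j<=r) sigma_j(M).
    Testing against Y with orthonormal rows bounds the nuclear norm of A + M
    from below by <Y, A> + <Y, M>.  Start from the polar factor of M and
    compose it with r Householder reflections so that it becomes a polar factor
    of A: then <Y, A> = |A|_*.  Each reflection lowers the trace of a
    compression by at most 2, so the coefficients of the sigma_j(M) in
    |M|_* - <Y, M> lie in [0, 2] and sum to at most 2r. *)

(** * The trace inner product and Householder reflections *)

Section InnerProduct.
Variable R : realType.

Definition ip m n (A B : 'M[R]_(m, n)) : R := \tr (A *m B^T).

Lemma ipE m n (A B : 'M[R]_(m, n)) :
  ip A B = \sum_(i < m) \sum_(j < n) A i j * B i j.
Proof.
apply: eq_bigr => i _; rewrite mxE; apply: eq_bigr => j _; by rewrite mxE.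
Qed.

Lemma ipC m n (A B : 'M[R]_(m, n)) : ip A B = ip B A.
Proof. by rewrite /ip -mxtrace_tr trmx_mul trmxK. Qed.

Lemma ipDl m n (A B C : 'M[R]_(m, n)) : ip (A + B) C = ip A C + ip B C.
Proof. by rewrite /ip mulmxDl raddfD. Qed.

Lemma ipZl m n a (A B : 'M[R]_(m, n)) : ip (a *: A) B = a * ip A B.
Proof. by rewrite /ip -scalemxAl mxtraceZ. Qed.

Lemma ipNl m n (A B : 'M[R]_(m, n)) : ip (- A) B = - ip A B.
Proof. by rewrite -scaleN1r ipZl mulN1r. Qed.

Lemma ip0l m n (B : 'M[R]_(m, n)) : ip 0 B = 0.
Proof. by rewrite /ip mul0mx mxtrace0. Qed.

Lemma ipDr m n (A B C : 'M[R]_(m, n)) : ip A (B + C) = ip A B + ip A C.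
Proof. by rewrite ipC ipDl !(ipC A). Qed.

Lemma ipZr m n a (A B : 'M[R]_(m, n)) : ip A (a *: B) = a * ip A B.
Proof. by rewrite ipC ipZl ipC. Qed.

Lemma ipNr m n (A B : 'M[R]_(m, n)) : ip A (- B) = - ip A B.
Proof. by rewrite ipC ipNl ipC. Qed.

Lemma ip0r m n (B : 'M[R]_(m, n)) : ip B 0 = 0.
Proof. by rewrite ipC ip0l. Qed.

Lemma ip_sumr m n (I : finType) (P : pred I) (A : 'M[R]_(m, n)) F :
  ip A (\sum_(i | P i) F i) = \sum_(i | P i) ip A (F i).
Proof.
by apply: (big_morph (ip A)) => [B C|]; rewrite ?ipDr ?ip0r.
Qed.

Lemma ip_mull m n p (A : 'M[R]_(m, n)) (B : 'M_(n, p)) C :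
  ip (A *m B) C = ip B (A^T *m C).
Proof. by rewrite /ip trmx_mul trmxK mulmxA -mulmxA mxtrace_mulC. Qed.

Lemma ip_mulr m n p (A : 'M[R]_(m, n)) (B : 'M_(n, p)) C :
  ip (A *m B) C = ip A (C *m B^T).
Proof. by rewrite /ip trmx_mul trmxK mulmxA. Qed.

Lemma ip_ge0 m n (A : 'M[R]_(m, n)) : 0 <= ip A A.
Proof.
by rewrite ipE; do 2!apply: sumr_ge0 => ? _; rewrite -expr2 sqr_ge0.
Qed.

Lemma ip_eq0 m n (A : 'M[R]_(m, n)) : (ip A A == 0) = (A == 0).
Proof.
apply/eqP/eqP => [|->]; last exact: ip0l.
rewrite ipE => /psumr_eq0P H; apply/matrixP => i j; rewrite mxE.
have {}H := H (fun i _ => sumr_ge0 _ (fun j _ => sqr_ge0 (A i j))) i isT.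
move/psumr_eq0P: H => /(_ (fun j _ => sqr_ge0 (A i j)) j isT)/eqP.
by rewrite mulf_eq0 orbb => /eqP.
Qed.

Lemma ip_gt0 m n (A : 'M[R]_(m, n)) : (0 < ip A A) = (A != 0).
Proof. by rewrite lt_def ip_ge0 andbT ip_eq0. Qed.

(** Expanding the squared norms of [A + B] and [A - B] suffices here, in place of the Cauchy-Schwarz
    inequality. *)
Lemma ip_le1 m n (A B : 'M[R]_(m, n)) :
  ip A A <= 1 -> ip B B <= 1 -> `|ip A B| <= 1.
Proof.
move=> hA hB; have := ip_ge0 (A + B); have := ip_ge0 (A - B).
rewrite !(ipDl, ipDr, ipNl, ipNr) (ipC B A) => h1 h2.
rewrite ler_norml; apply/andP; split; lra.
Qed.

Lemma ip_row m n (A B : 'M[R]_(m, n)) i j :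
  ip (row i A) (row j B) = (A *m B^T) i j.
Proof.
rewrite ipE big_ord1 mxE; apply: eq_bigr => k _; by rewrite !mxE.
Qed.

Lemma row_mulmx_tr n (x y : 'rV[R]_n) : x *m y^T = (ip x y)%:M.
Proof. by rewrite {1}[x *m _]mx11_scalar /ip trace_mx11. Qed.

Lemma orthonormal_rows m n (A : 'M[R]_(m, n)) i j :
  A *m A^T = 1%:M -> ip (row i A) (row j A) = (i == j)%:R.
Proof. by move=> AA; rewrite ip_row AA mxE. Qed.

(* At [w = 0] this is the identity, since [0^-1 = 0]. *)
Definition reflection n (w : 'rV[R]_n) : 'M[R]_n :=
  1%:M - (2 / ip w w) *: (w^T *m w).

Lemma tr_reflection n (w : 'rV[R]_n) : (reflection w)^T = reflection w.
Proof. by rewrite /reflection linearB linearZ /= trmx1 trmx_mul trmxK. Qed.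

Lemma mul_reflection n (w x : 'rV[R]_n) :
  x *m reflection w = x - (2 * ip x w / ip w w) *: w.
Proof.
rewrite /reflection mulmxBr mulmx1 -scalemxAr mulmxA row_mulmx_tr mul_scalar_mx.
by rewrite scalerA mulrAC.
Qed.

Lemma reflectionK n (w : 'rV[R]_n) : reflection w *m reflection w = 1%:M.
Proof.
apply/row_matrixP => i; rewrite !rowE mulmxA !mul_reflection mulmx1.
set x := delta_mx _ _.
have [->|w0] := eqVneq w 0; first by rewrite !scaler0 !subr0.
rewrite ipDl ipNl ipZl -addrA -opprD -scalerDl.
rewrite -[RHS]subr0 -(scale0r w); congr (_ - _ *: _).
by field; rewrite ip_eq0.
Qed.

(** For [w = x - c], equality of norms gives [2 * ip x w = ip w w], so the reflection subtracts
    exactly [w] from [x]. *)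
Lemma reflection_sub n (x c : 'rV[R]_n) :
  ip x x = ip c c -> x *m reflection (x - c) = c.
Proof.
move=> xc; rewrite mul_reflection.
have [/eqP|w0] := eqVneq (x - c) 0.
  by rewrite subr_eq0 => /eqP ->; rewrite subrr scaler0 subr0.
suff -> : 2 * ip x (x - c) / ip (x - c) (x - c) = 1.
  by rewrite scale1r opprB addrC subrK.
apply: (canLR (mulfK _)); first by rewrite ip_eq0.
rewrite !(ipDl, ipDr, ipNl, ipNr) (ipC c x) xc; lra.
Qed.

Lemma reflection_ortho n (x w : 'rV[R]_n) : ip x w = 0 -> x *m reflection w = x.
Proof. by move=> xw; rewrite mul_reflection xw mulr0 mul0r scale0r subr0. Qed.

End InnerProduct.

(** * The spectral theorem for real symmetric matrices *)

Section Spectral.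
Variable R : realType.
Local Open Scope complex_scope.

(** Over the complex numbers [A] is Hermitian, hence diagonalizable with real spectrum; a real root
    of the complexified characteristic polynomial is already a root over [R]. *)
Lemma symmetric_eigenvalue n (A : 'M[R]_n.+1) :
  A^T = A -> exists a : R, eigenvalue A a.
Proof.
move=> Asym; pose f := real_complex R; pose B := map_mx f A.
have Bherm : B \is hermsymmx.
  apply: realsym_hermsym.
    by apply/is_hermitianmxP; rewrite expr0 scale1r map_mx_id // map_trmx Asym.
  by apply/mxOverP => i j; rewrite mxE; apply/complex_realP; exists (A i j).
have := hermitian_normalmx Bherm => /orthomx_spectralP Beq.
have /mxOverP/(_ 0 0)/complex_realP[a da] := hermitian_spectral_diag_real Bherm.
exists a; rewrite eigenvalue_root_char.
suff : eigenvalue B (f a).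
  by rewrite eigenvalue_root_char /B -map_char_poly fmorph_root.
apply/eigenvalueP; exists (row 0 (spectralmx B)).
  rewrite {2}Beq -row_mul !mulmxA mulmxV ?spectral_unit // mul1mx.
  by rewrite row_mul row_diag_mx -scalemxAl -rowE da.
apply/eqP => r0; have := spectral_unit B.
rewrite -row_free_unit => /row_freeP[C /(congr1 (row 0))].
rewrite row_mul r0 mul0mx => /matrixP/(_ 0 0); rewrite !mxE => /eqP.
by rewrite eq_sym oner_eq0.
Qed.

(** Induction on the size: conjugating by the reflection that exchanges the first basis vector with
    a unit eigenvector clears the first row, and by symmetry the first column, off the diagonal. *)
Lemma symmetric_diagonalizable n (A : 'M[R]_n) : A^T = A ->
  exists (U : 'M_n) (d : 'rV_n), U *m U^T = 1%:M /\ U *m A *m U^T = diag_mx d.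
Proof.
elim: n A => [|n IHn] A Asym.
  by exists 1%:M, 0; split; apply/matrixP => -[].
have [a /eigenvalueP[v vA v0]] := symmetric_eigenvalue Asym.
pose u := (Num.sqrt (ip v v))^-1 *: v.
have u1 : ip u u = 1.
  rewrite ipZl ipZr mulrA -expr2 exprVn sqr_sqrtr ?ip_ge0 // mulVf //.
  by rewrite ip_eq0.
pose e : 'rV[R]_(1 + n) := delta_mx 0 0.
have e1 : ip e e = 1.
  have := @orthonormal_rows R _ _ 1%:M (0 : 'I_(1 + n)) 0.
  by rewrite trmx1 mulmx1 !rowE mulmx1 => ->.
pose H := reflection (e - u); have HT : H^T = H := tr_reflection _.
have HH : H *m H = 1%:M := reflectionK _.
have eH : e *m H = u by rewrite reflection_sub // e1.
pose B : 'M_(1 + n) := H *m A *m H.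
have BT : B^T = B by rewrite /B !trmx_mul HT Asym mulmxA.
have uA : u *m A = a *: u by rewrite -scalemxAl vA scalerA mulrC -scalerA.
have eB : row 0 B = a *: e.
  rewrite rowE /B !mulmxA eH uA -scalemxAl -eH -mulmxA HH.
  by rewrite mulmx1.
have Bur : ursubmx B = 0.
  apply/matrixP => i j; rewrite ord1.
  have /matrixP/(_ 0 (rshift 1 j)) := eB.
  rewrite [LHS]mxE [X in _ = X]mxE [e _ _]mxE /= mulr0 => eBj.
  rewrite [LHS]mxE [LHS]mxE [RHS]mxE -[RHS]eBj.
  by congr (B _ _); apply/val_inj.
have Bdl : dlsubmx B = 0 by rewrite -BT -trmx_ursub Bur trmx0.
have [] := IHn (drsubmx B); first by rewrite trmx_drsub BT.
move=> V [d [VV Vd]].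
pose W : 'M_(1 + n) := block_mx 1%:M 0 0 V.
have WT : W^T = block_mx 1%:M 0 0 V^T by rewrite tr_block_mx !trmx0 trmx1.
have WW : W *m W^T = 1%:M.
  rewrite WT mulmx_block VV !(mulmx0, mul0mx, mulmx1, addr0, add0r).
  by rewrite -scalar_mx_block.
pose l := ulsubmx B.
exists (W *m H), (row_mx l d); split.
  by rewrite trmx_mul HT mulmxA -[X in X *m _]mulmxA HH mulmx1.
have -> : W *m H *m A *m (W *m H)^T = W *m B *m W^T.
  by rewrite trmx_mul HT /B !mulmxA.
rewrite WT -[B]submxK Bur Bdl !mulmx_block.
rewrite !(mulmx0, mul0mx, mulmx1, mul1mx, addr0, add0r) Vd.
have D := diag_mx_row l d.
refine (etrans _ (esym D)).
by congr block_mx; apply/matrixP => i j; rewrite !ord1 [RHS]mxE.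
Qed.

End Spectral.

(** * Eigenvalue lists, singular values and rank *)

Section SingularValues.
Variable R : realType.

Lemma char_poly_diagonalized n (A U : 'M[R]_n) d :
  U *m U^T = 1%:M -> U *m A *m U^T = diag_mx d ->
  char_poly A = \prod_(i < n) ('X - (d 0 i)%:P).
Proof.
move=> UU UAU.
transitivity (char_poly (diag_mx d)).
  pose V := map_mx polyC U; have VV : V *m V^T = 1%:M.
    by rewrite map_trmx -map_mxM UU map_mx1.
  have VVd : \det V * \det V^T = 1 by rewrite -det_mulmx VV det1.
  rewrite /char_poly -[\det _]mul1r -VVd -mulrA (mulrC (\det V^T)) mulrA.
  rewrite -!det_mulmx /char_poly_mx mulmxBr mulmxBl -UAU !map_mxM -map_trmx -/V.
  by rewrite scalar_mxC -[in X in \det (X - _)]mulmxA VV mulmx1.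
rewrite char_poly_trig; last by apply/is_diag_mx_is_trig/diag_mx_is_diag.
by apply: eq_bigr => i _; rewrite mxE eqxx.
Qed.

(** Each [x] occurs in either list as often as its multiplicity as a root of [char_poly A]. *)
Lemma perm_eigenvalues n (A : 'M[R]_n) (s : seq R) :
  char_poly A = \prod_(x <- s) ('X - x%:P) -> perm_eq (eigenvalues A) s.
Proof.
move=> pA; apply/allP => x _ /=; apply/eqP.
rewrite count_sort count_flatten -map_comp -mu_prod_XsubC -pA.
have p0 : char_poly A != 0 by rewrite monic_neq0 ?char_poly_monic.
have rts y : (y \in rootsR (char_poly A)) = root (char_poly A) y.
  by rewrite -roots_on_rootsR // inE.
under eq_map => y do rewrite /= count_nseq /=.
rewrite sumnE big_map.
have [xr|xr] := boolP (x \in rootsR (char_poly A)).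
  rewrite (bigD1_seq x) ?uniq_roots //= eqxx mul1n big1 ?addn0 // => y yx.
  by rewrite (negPf yx).
rewrite big1_seq ?mupNroot -?rts // => y /= yr.
by case: eqP yr xr => // -> ->.
Qed.

(** Permuting the rows of an orthogonal diagonalizer puts the diagonal in the sorted order of
    [eigenvalues]. *)
Lemma eigenvalues_spectral n (A : 'M[R]_n) : A^T = A ->
  size (eigenvalues A) = n /\
  exists U : 'M[R]_n, U *m U^T = 1%:M /\
    U *m A *m U^T = diag_mx (\row_j (eigenvalues A)`_j).
Proof.
move=> /symmetric_diagonalizable[U [d [UU UAU]]].
pose t : n.-tuple R := [tuple d 0 i | i < n].
have pe : perm_eq (eigenvalues A) t.
  apply: perm_eigenvalues; rewrite (char_poly_diagonalized UU UAU).
  by rewrite big_tuple; apply: eq_bigr => i _; rewrite tnth_mktuple.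
split; first by rewrite (perm_size pe) size_tuple.
have /tuple_permP[p pE] := pe.
have dp (j : 'I_n) : (eigenvalues A)`_j = d 0 (p j).
  by rewrite pE -tnth_nth !tnth_mktuple.
exists (row_perm p U); split.
  apply/matrixP => i j; rewrite -ip_row !row_permEsub !row_rowsub ip_row UU !mxE.
  by rewrite (inj_eq perm_inj).
apply/matrixP => i j; rewrite -ip_row row_mul !row_permEsub row_rowsub -row_mul.
rewrite row_rowsub ip_row UAU [LHS]mxE [RHS]mxE [X in _ = X *+ _]mxE dp.
by rewrite (inj_eq perm_inj).
Qed.

Variables n N : nat.
Implicit Types M : 'M[R]_(n, N).

Lemma gram_sym M : (M *m M^T)^T = M *m M^T.
Proof. by rewrite trmx_mul trmxK. Qed.

Lemma sigmaE M (j : 'I_n) : sigma M j.+1 = Num.sqrt (eigenvalues (M *m M^T))`_j.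
Proof.
by rewrite /sigma (nth_map 0) // (eigenvalues_spectral (gram_sym M)).1 ltn_ord.
Qed.

Lemma sigma_ge0 M j : 0 <= sigma M j.
Proof.
have [h|h] := ltnP j.-1 (size (singular_values M)); last first.
  by rewrite /sigma nth_default.
by move: h; rewrite size_map => h; rewrite /sigma (nth_map 0) ?sqrtr_ge0.
Qed.

Lemma sigma_le M (i j : 'I_n) : (i <= j)%N -> sigma M j.+1 <= sigma M i.+1.
Proof.
move=> ij; rewrite !sigmaE ler_wsqrtr //.
have sz := (eigenvalues_spectral (gram_sym M)).1.
have geT : total (>=%R : rel R) by move=> x y; apply: le_total.
have geX : transitive (>=%R : rel R) by move=> x y z /= h1 h2; apply: le_trans h1.
apply: (sorted_leq_nth geX (fun x => lexx x) 0 (sort_sorted geT _)) => //;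
  by rewrite inE -/(eigenvalues _) sz.
Qed.

(** A singular value decomposition without right singular vectors: the rows of [U *m M] are
    orthogonal with norms [sigma M j.+1]. *)
Lemma gram_spectral M : exists U : 'M[R]_n, U *m U^T = 1%:M /\
  (U *m M) *m (U *m M)^T = diag_mx (\row_j sigma M j.+1 ^+ 2).
Proof.
have [_ [U [UU UMU]]] := eigenvalues_spectral (gram_sym M).
exists U; split => //.
have E : (U *m M) *m (U *m M)^T = U *m (M *m M^T) *m U^T.
  by rewrite trmx_mul !mulmxA.
rewrite E UMU; congr diag_mx; apply/rowP => j; rewrite !mxE sigmaE sqr_sqrtr //.
(* The eigenvalue is the squared norm of a row, so squaring undoes its square root. *)
have := ip_ge0 (row j (U *m M)); rewrite ip_row E UMU !mxE eqxx.
by rewrite mulr1n.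
Qed.

(** Otherwise the first [j.+1] rows of [U *m M] are orthogonal and nonzero, hence independent. *)
Lemma sigma_gt_rank M (j : 'I_n) : (\rank M <= j)%N -> sigma M j.+1 = 0.
Proof.
move=> rM; apply/eqP/negPn/negP => sj.
have [U [UU UM]] := gram_spectral M.
have jn : (j.+1 <= n)%N := ltn_ord j.
pose S := rowsub (widen_ord jn) (U *m M).
have SS : S *m S^T = diag_mx (\row_i sigma M i.+1 ^+ 2).
  apply/matrixP => a b.
  rewrite -ip_row !row_rowsub ip_row UM [LHS]mxE [RHS]mxE.
  by rewrite [X in X *+ _]mxE [X in _ = X *+ _]mxE.
have : (j.+1 <= \rank S)%N.
  apply: leq_trans (mxrankM_maxl S S^T).
  suff /mxrank_unit -> : S *m S^T \in unitmx by [].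
  rewrite SS unitmxE det_diag unitfE; apply/prodf_neq0 => i _.
  rewrite mxE sqrf_eq0 gt_eqF //.
  apply: lt_le_trans (sigma_le M (_ : widen_ord jn i <= j)%N).
    by rewrite lt_def sj sigma_ge0.
  by rewrite /= -ltnS.
apply/negP; rewrite -leqNgt (leq_trans _ rM) //.
by apply: leq_trans (mxrankS (rowsub_sub _ _)) (mxrankM_maxr _ _).
Qed.

End SingularValues.

(** * From restricted isometry to the null space property *)

Section NullSpaceProperty.
Variable R : realType.

Lemma frobenius_norm_sqr n N (A : 'M[R]_(n, N)) : frobenius_norm A ^+ 2 = ip A A.
Proof.
by rewrite -[RHS]sqr_sqrtr ?ip_ge0 // ipE.
Qed.

Lemma l2_norm_sqr m (v : 'cV[R]_m) : l2_norm v ^+ 2 = ip v v.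
Proof.
rewrite -[RHS]sqr_sqrtr ?ip_ge0 // ipE.
by congr (Num.sqrt _ ^+ 2); apply: eq_bigr => i _; rewrite big_ord1.
Qed.

Lemma nuclear_normE n N (M : 'M[R]_(n, N)) :
  nuclear_norm M = \sum_(j < n) sigma M j.+1.
Proof. by rewrite /nuclear_norm big_add1 big_mkord. Qed.

Lemma head_sumE n N (M : 'M[R]_(n, N)) r : (r <= n)%N ->
  \sum_(1 <= j < r.+1) sigma M j = \sum_(j < n | (j < r)%N) sigma M j.+1.
Proof.
move=> rn; rewrite big_add1 big_mkord.
by rewrite (big_ord_widen _ (fun j => sigma M j.+1) rn).
Qed.

Lemma nuclear_norm_split n N (M : 'M[R]_(n, N)) r : (r <= n)%N ->
  nuclear_norm M = \sum_(1 <= j < r.+1) sigma M j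
                   + \sum_(r.+1 <= j < n.+1) sigma M j.
Proof. by move=> rn; rewrite /nuclear_norm (@big_cat_nat _ _ _ r.+1). Qed.

(** With [a], [b] the norms of [A], [B], use the upper RIP bound at [b *: A - a *: B] and the lower
    one at [b *: A + a *: B]. Both have squared norm [2 * a ^+ 2 * b ^+ 2], so subtraction leaves
    [4 * a * b] times the claim. *)
Lemma RIP_polarization n N m (X : {linear 'M[R]_(n, N) -> 'cV[R]_m}) r delta
    (A B : 'M[R]_(n, N)) :
  has_RIP X (2 * r) delta -> (\rank A <= r)%N -> (\rank B <= r)%N ->
  ip A B = 0 ->
  - ip (X A) (X B) <= delta * (frobenius_norm A * frobenius_norm B).
Proof.
move=> [d0 rip] rA rB AB.
have [a2 b2] := (frobenius_norm_sqr A, frobenius_norm_sqr B).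
have a0 : 0 <= frobenius_norm A := sqrtr_ge0 _.
have b0 : 0 <= frobenius_norm B := sqrtr_ge0 _.
set a := frobenius_norm A in a2 a0 *; set b := frobenius_norm B in b2 b0 *.
have [az|az] := eqVneq a 0.
  have -> : A = 0 by apply/eqP; rewrite -ip_eq0 -a2 az expr0n.
  by rewrite linear0 ip0l az mul0r mulr0 oppr0.
have [bz|bz] := eqVneq b 0.
  have -> : B = 0 by apply/eqP; rewrite -ip_eq0 -b2 bz expr0n.
  by rewrite linear0 ip0r bz !mulr0 oppr0.
have rk c : (\rank (b *: A + c *: B)%R <= 2 * r)%N.
  rewrite mul2n -addnn (leq_trans (mxrank_add _ _)) //.
  by rewrite leq_add // (leq_trans (mxrank_scale _ _)).
have /andP[_ h1] := rip _ (rk (- a)); have /andP[h2 _] := rip _ (rk a).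
move: h1 h2; rewrite !l2_norm_sqr !frobenius_norm_sqr !linearD !linearZ /=.
rewrite !(ipDl, ipDr, ipZl, ipZr) (ipC B) AB (ipC (X B)) -a2 -b2.
set p := ip (X A) (X B); set x := ip (X A) (X A); set y := ip (X B) (X B).
move=> h1 h2.
have ab : 0 < 4 * (a * b).
  by rewrite mulr_gt0 // mulr_gt0 // lt_def ?az ?bz.
rewrite -(ler_pM2l ab); nra.
Qed.

(** * Blocks of [r] consecutive singular values *)

Section Blocks.
Variables (n r : nat).
Hypothesis r0 : (0 < r)%N.

(** Indices count from 0, so block 0 holds the [r] largest singular values when [r <= n]; the last
    nonempty block may be short. *)
Definition block (k : nat) : pred 'I_n := fun j => (j %/ r)%N == k.

Lemma card_block_le k : (#|block k| <= r)%N.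
Proof.
pose f (j : 'I_n) : 'I_r := Ordinal (ltn_pmod j r0).
have fI : {in block k &, injective f}.
  move=> i j /eqP ik /eqP jk [ij]; apply/val_inj => /=.
  by rewrite (divn_eq i r) (divn_eq j r) ik jk ij.
by rewrite -(card_in_image fI) -[X in (_ <= X)%N](card_ord r) max_card.
Qed.

(** A block followed by a nonempty one is full. *)
Lemma card_block_ge k (j : 'I_n) : j \in block k.+1 -> (r <= #|block k|)%N.
Proof.
move=> /eqP jk.
have kr (i : 'I_r) : (k * r + i < n)%N.
  apply: leq_ltn_trans (ltn_ord j); rewrite (divn_eq j r) jk mulSn.
  rewrite [(r + _)%N]addnC -addnA leq_add2l.
  by rewrite (leq_trans (ltnW (ltn_ord i))) ?leq_addr.
pose f (i : 'I_r) : 'I_n := Ordinal (kr i).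
have fI : injective f by move=> x y [/addnI] /val_inj.
rewrite -[X in (X <= _)%N](card_ord r) -(card_codom fI) subset_leq_card //.
apply/subsetP => _ /codomP[i ->]; apply/eqP => /=.
by rewrite divnMDl // divn_small // addn0.
Qed.

Lemma rank_block k : (\rank (diag_mx (\row_j (block k j)%:R) : 'M[R]_n) <= r)%N.
Proof.
have -> : diag_mx (\row_j (block k j)%:R) =
          \sum_(j in block k) delta_mx j j :> 'M[R]_n.
  rewrite diag_mx_sum_delta [RHS]big_mkcond; apply: eq_bigr => j _.
  rewrite mxE; have -> : (j \in block k) = block k j by [].
  by case: (block k j); rewrite ?scale1r ?scale0r.
apply: leq_trans (card_block_le k); rewrite -sum1_card.
apply: (big_ind2 (fun (A : 'M[R]_n) c => \rank A <= c)%N) => [|A c B d Ac Bd|j _].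
- by rewrite mxrank0.
- exact: leq_trans (mxrank_add _ _) (leq_add Ac Bd).
- by rewrite mxrank_delta.
Qed.

End Blocks.

Lemma gram_diag_ip n N (W : 'M[R]_(n, N)) (s a b : 'rV[R]_n) :
  W *m W^T = diag_mx s ->
  ip (diag_mx a *m W) (diag_mx b *m W) = \sum_j a 0 j * b 0 j * s 0 j.
Proof.
move=> WW; rewrite /ip trmx_mul tr_diag_mx mulmxA -[X in X *m _]mulmxA WW.
rewrite !mulmx_diag mxtrace_diag; apply: eq_bigr => j _; rewrite !mxE.
by rewrite mulrAC.
Qed.

Section BlockBounds.
Variables (n N r : nat) (M : 'M[R]_(n, N)).
Hypothesis r0 : (0 < r)%N.
Let s (j : 'I_n) := sigma M j.+1.
Let b (k : nat) := \sum_(j < n | block r k j) s j.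
Let q (k : nat) := \sum_(j < n | block r k j) s j ^+ 2.

Lemma sum_block_ge0 k : 0 <= b k.
Proof. by apply: sumr_ge0 => j _; apply: sigma_ge0. Qed.

Lemma sum_const_block k (c : R) :
  \sum_(j < n | block r k j) c = #|@block n r k|%:R * c :> R.
Proof. by rewrite sumr_const mulr_natl. Qed.

(** If block [k.+1] is nonempty then block [k] is full, so each [s j] in the former is at most
    [b k / r]; square and sum over at most [r] indices. *)
Lemma block_sqr_le k : r%:R * q k.+1 <= b k ^+ 2.
Proof.
have rp : 0 < r%:R :> R by rewrite ltr0n.
have pt j : block r k.+1 j -> r%:R * s j <= b k.
  move=> jk; apply: (@le_trans _ _ (#|@block n r k|%:R * s j)).
    by rewrite ler_wpM2r ?sigma_ge0 // ler_nat (card_block_ge r0 jk).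
  rewrite -sum_const_block; apply: ler_sum => i ik; apply: sigma_le.
  rewrite leqNgt; apply/negP => /ltnW /(leq_div2r r).
  by rewrite (eqP jk) (eqP ik) ltnn.
rewrite -(ler_pM2l rp) mulrA -expr2 mulr_sumr.
apply: (@le_trans _ _ (\sum_(j < n | block r k.+1 j) b k ^+ 2)).
  apply: ler_sum => j /pt h; rewrite -exprMn.
  by rewrite ler_pXn2r ?nnegrE ?sum_block_ge0 ?mulr_ge0 ?sigma_ge0 ?ler0n.
by rewrite sum_const_block ler_wpM2r ?sqr_ge0 // ler_nat card_block_le.
Qed.

(** Cauchy-Schwarz, from the squared deviations from [b k / r]. Dividing by [r] rather than by the
    block size also covers a short block. *)
Lemma block_sum_sqr k : b k ^+ 2 <= r%:R * q k.
Proof.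
have rp : 0 < r%:R :> R by rewrite ltr0n.
pose c := b k / r%:R.
have bc : b k = r%:R * c by rewrite mulrC divfK ?gt_eqF.
have : 0 <= \sum_(j < n | block r k j) (s j - c) ^+ 2.
  by apply: sumr_ge0 => j _; apply: sqr_ge0.
have -> : \sum_(j < n | block r k j) (s j - c) ^+ 2
          = q k - 2 * c * b k + #|@block n r k|%:R * c ^+ 2.
  rewrite -sum_const_block mulr_sumr -sumrB -big_split; apply: eq_bigr => j _ /=.
  ring.
have : #|@block n r k|%:R * c ^+ 2 <= r%:R * c ^+ 2.
  by rewrite ler_wpM2r ?sqr_ge0 // ler_nat card_block_le.
rewrite bc => h1 h2.
have : 0 <= r%:R * (q k - r%:R * c ^+ 2).
  by apply: mulr_ge0; [exact: ltW|lra].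
by rewrite mulrBr subr_ge0 mulrA -expr2 -exprMn.
Qed.

End BlockBounds.

Lemma RIP_NSP n N m r (X : {linear 'M[R]_(n, N) -> 'cV[R]_m}) delta :
  (1 <= r <= n)%N -> has_RIP X (2 * r) delta -> delta < 1 / 3 -> has_NSP X r.
Proof.
case: n X => [|n] X; first by case: r.
move=> /andP[r0 rn] rip d3 M XM M0; have [d0 ripX] := rip.
have [U [UU WW]] := gram_spectral M; set W := U *m M in WW.
have UtU : U^T *m U = 1%:M := mulmx1C UU.
have WM : U^T *m W = M by rewrite mulmxA UtU mul1mx.
pose s (j : 'I_n.+1) := sigma M j.+1.
pose b k := \sum_(j < n.+1 | block r k j) s j.
pose D k : 'M[R]_n.+1 := diag_mx (\row_j (block r k j)%:R).
(* The [k]-th block of the singular value decomposition of [M]: [D k] keeps the rows of [W] in block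
   [k]. *)
pose P k := U^T *m (D k *m W).
have ipP k l : ip (P k) (P l) =
    \sum_(j < n.+1) (block r k j)%:R * (block r l j)%:R * s j ^+ 2.
  rewrite ip_mull trmxK [U *m _]mulmxA UU mul1mx (gram_diag_ip _ _ WW).
  by apply: eq_bigr => j _; rewrite !mxE.
have ipPP k : ip (P k) (P k) = \sum_(j < n.+1 | block r k j) s j ^+ 2.
  rewrite ipP [RHS]big_mkcond; apply: eq_bigr => j _.
  by case: (block r k j); rewrite ?mul1r ?mul0r.
have ipP0 k : ip (P 0%N) (P k.+1) = 0.
  rewrite ipP big1 // => j _; rewrite /block.
  by case: eqP => [->|_]; rewrite ?mulr0 !mul0r.
have rkP k : (\rank (P k) <= r)%N.
  apply: leq_trans (mxrankM_maxr _ _) _.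
  exact: leq_trans (mxrankM_maxl _ _) (rank_block _ r0 k).
(* A crude bound on the number of blocks; surplus blocks are empty and contribute zero. *)
have kn (j : 'I_n.+1) : (j %/ r < n.+1)%N.
  by apply: leq_ltn_trans (leq_div _ _) (ltn_ord j).
have sumD : \sum_(k < n.+1) D k = 1%:M.
  apply/matrixP => i j; rewrite summxE [RHS]mxE.
  rewrite (bigD1 (Ordinal (kn i))) //= big1 ?addr0 => [|k ki].
    by rewrite !mxE eq_sym /block eqxx; case: eqP.
  rewrite !mxE /block; case: (i == j); last by rewrite mulr0n.
  by rewrite eq_sym -[_ == _]/(k == Ordinal (kn i)) (negPf ki).
have sumP : M = \sum_(k < n.+1) P k.
  by rewrite -mulmx_sumr -mulmx_suml sumD mul1mx.
pose f k := frobenius_norm (P k).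
have f0 k : 0 <= f k := sqrtr_ge0 _.
pose t : R := Num.sqrt r%:R.
have t0 : 0 < t by rewrite sqrtr_gt0 ltr0n.
have t2 : t ^+ 2 = r%:R by rewrite sqr_sqrtr.
have tf2 k : (t * f k) ^+ 2 = r%:R * \sum_(j < n.+1 | block r k j) s j ^+ 2.
  by rewrite exprMn t2 frobenius_norm_sqr ipPP.
have tail k : t * f k.+1 <= b k.
  rewrite -(@ler_pXn2r _ 2) ?nnegrE ?mulr_ge0 ?(ltW t0) ?sum_block_ge0 //.
  by rewrite tf2 block_sqr_le.
have head : b 0%N <= t * f 0%N.
  rewrite -(@ler_pXn2r _ 2) ?nnegrE ?mulr_ge0 ?(ltW t0) ?sum_block_ge0 //.
  by rewrite tf2 block_sum_sqr.
have sumb : \sum_(k < n.+1) b k = nuclear_norm M.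
  rewrite nuclear_normE [RHS](partition_big (fun j => Ordinal (kn j)) predT) //=.
have b0E : b 0%N = \sum_(1 <= j < r.+1) sigma M j.
  rewrite head_sumE //; apply: eq_bigl => j.
  by rewrite /block -leqn0 leqNgt divn_gt0 // -ltnNge.
(* Since [M] is nonzero its largest singular value is positive; strictness of the final inequality
   rests on this. *)
have s0 : 0 < s ord0.
  rewrite lt_def sigma_ge0 andbT; apply/eqP => s0; case/eqP: M0.
  apply/eqP; rewrite -ip_eq0 -{1}WM ip_mull trmxK -/W /ip WW mxtrace_diag.
  rewrite big1 // => j _; rewrite mxE.
  suff -> : sigma M j.+1 = 0 by rewrite expr0n.
  by apply/eqP; rewrite eq_le sigma_ge0 andbT -s0 sigma_le.
have b0 : 0 < b 0%N.
  apply: lt_le_trans s0 _; rewrite /b (bigD1 ord0) ?lerDl /=.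
    by apply: sumr_ge0 => j _; apply: sigma_ge0.
  by rewrite /block div0n.
have fp : 0 < f 0%N.
  by have := lt_le_trans b0 head; rewrite pmulr_rgt0.
(* Multiply by [f 0]. The lower RIP bound applies to [P 0], and [X M = 0] turns
   [ip (X (P 0)) (X (P 0))] into minus the sum of the cross terms. *)
have key : (1 - delta) * f 0%N <= delta * \sum_(k < n) f k.+1.
  rewrite -(ler_pM2l fp) mulrCA -expr2.
  have /andP[h _] := ripX (P 0%N) (leq_trans (rkP 0%N) (leq_pmull r (ltn0Sn 1))).
  apply: le_trans h _; rewrite l2_norm_sqr.
  have : ip (X (P 0%N)) (X M) = 0 by rewrite XM ip0r.
  rewrite {1}sumP big_ord_recl linearD linear_sum ipDr ip_sumr /=.
  move/eqP; rewrite addr_eq0 => /eqP ->; rewrite -sumrN mulrCA !mulr_sumr.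
  by apply: ler_sum => k _; apply: RIP_polarization rip _ _ _.
have {}key : (1 - delta) * b 0%N <= delta * nuclear_norm M.
  have d1 : 0 <= 1 - delta by lra.
  apply: (le_trans (ler_wpM2l d1 head)); rewrite mulrCA.
  apply: (le_trans (ler_wpM2l (ltW t0) key)); rewrite mulrCA ler_pM2l //.
  rewrite -sumb big_ord_recr /= mulr_sumr.
  apply: (@le_trans _ _ (\sum_(k < n) b k)); last by rewrite lerDl sum_block_ge0.
  by apply: ler_sum => k _; apply: tail.
(* With head [h] and tail [T] this reads [(1 - 2 * delta) * h <= delta * T]; as [h > 0] and
   [0 < delta < 1 / 3], it forces [h < T]. *)
move: key b0; rewrite (nuclear_norm_split M rn) b0E => key b0; nra.
Qed.

End NullSpaceProperty.

(** * Lower bounds on the nuclear norm by duality *)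

Section NuclearNorm.
Variable R : realType.

(* The [n] zero columns leave room to complete the right singular vectors to
   [n] orthonormal rows even when [M] has fewer than [n] nonzero singular
   values; [0^-1 = 0] makes [diag_mx s^-1] vanish on the others. *)
Lemma padded_svd n N (M : 'M[R]_(n, N)) :
  exists (U : 'M[R]_n) (B : 'M[R]_(n, N + n)),
    [/\ U *m U^T = 1%:M, B *m B^T = 1%:M
      & row_mx M 0 = U^T *m diag_mx (\row_j sigma M j.+1) *m B].
Proof.
have [U [UU WW]] := gram_spectral M; set W := U *m M in WW.
have WM : U^T *m W = M by rewrite mulmxA (mulmx1C UU) mul1mx.
pose D (f : R -> R) : 'M[R]_n := diag_mx (\row_j f (sigma M j.+1)).
have DD f g : D f *m D g = D (fun x => f x * g x).
  by rewrite mulmx_diag; congr diag_mx; apply/rowP => j; rewrite !mxE.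
have D1 f : (forall x, f x = 1) -> D f = 1%:M.
  by move=> f1; apply/matrixP => i j; rewrite !mxE f1.
have DT f : (D f)^T = D f by apply: tr_diag_mx.
have WD : W *m W^T = D (fun x => x ^+ 2) by [].
(* Row [j] is the normalized row of [W] if its singular value is nonzero, and otherwise the [j]-th
   unit vector of the padding. *)
exists U, (row_mx (D (fun x => x^-1) *m W) (D (fun x => (x == 0)%:R))).
split=> //.
  rewrite tr_row_mx mul_row_col trmx_mul !DT mulmxA -[X in X *m _ + _]mulmxA.
  rewrite WD !DD /D -raddfD /= -[RHS](D1 (fun=> 1)) //; congr diag_mx.
  apply/rowP => j; rewrite !mxE; have [->|x0] := eqVneq.
    by rewrite invr0 !mul0r mulr1 add0r.
  by rewrite mulr0 addr0; field.
rewrite -mulmxA mul_mx_row mulmxA -/(D id) !DD mul_mx_row.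
congr row_mx.
  rewrite -[LHS]WM; congr (_ *m _); apply/row_matrixP => j.
  rewrite row_mul row_diag_mx -scalemxAl -rowE mxE.
  have [x0|x0] := eqVneq (sigma M j.+1) 0; last by rewrite divff ?scale1r.
  rewrite x0 mul0r scale0r; apply/eqP; rewrite -ip_eq0 ip_row WW !mxE eqxx.
  by rewrite x0 expr0n.
rewrite (_ : D (fun x => id x * (x == 0)%:R) = 0) ?mulmx0 //.
apply/matrixP => i j; rewrite !mxE.
by have [->|_] := eqVneq (sigma M i.+1); rewrite ?mul0r ?mulr0 mul0rn.
Qed.

Lemma ip_diag_mx n (s : 'rV[R]_n) A : ip (diag_mx s) A = \sum_j s 0 j * A j j.
Proof. by rewrite /ip mul_diag_mx; apply: eq_bigr => j _; rewrite !mxE. Qed.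

Lemma ip_svd n L (Y : 'M[R]_(n, L)) (U : 'M[R]_n) B s :
  ip Y (U^T *m diag_mx s *m B) = \sum_j s 0 j * (U *m Y *m B^T) j j.
Proof. by rewrite ipC ip_mulr ip_mull trmxK ip_diag_mx mulmxA. Qed.

Lemma mulmx_orthonormal n m L (U : 'M[R]_(n, m)) (B : 'M[R]_(m, L)) :
  U *m U^T = 1%:M -> B *m B^T = 1%:M -> (U *m B) *m (U *m B)^T = 1%:M.
Proof.
by move=> UU BB; rewrite trmx_mul mulmxA -[X in X *m _]mulmxA BB mulmx1 UU.
Qed.

Lemma orthonormal_ip_le1 n L (Y B : 'M[R]_(n, L)) j :
  Y *m Y^T = 1%:M -> B *m B^T = 1%:M -> `|(Y *m B^T) j j| <= 1.
Proof.
by move=> YY BB; rewrite -ip_row ip_le1 // orthonormal_rows // eqxx.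
Qed.

(** Pairing with [Y] weights each singular value by a diagonal entry of a product of two matrices
    with orthonormal rows, which is at most 1. *)
Lemma ip_le_nuclear_norm n N (Y : 'M[R]_(n, N + n)) (Z : 'M[R]_(n, N)) :
  Y *m Y^T = 1%:M -> ip Y (row_mx Z 0) <= nuclear_norm Z.
Proof.
move=> YY; have [U [B [UU BB ->]]] := padded_svd Z.
rewrite ip_svd nuclear_normE; apply: ler_sum => j _; rewrite mxE.
rewrite -[leRHS]mulr1 ler_wpM2l ?sigma_ge0 // (le_trans (ler_norm _)) //.
by rewrite orthonormal_ip_le1 // mulmx_orthonormal.
Qed.

(** Expand the squared norm of [v] minus its orthogonal projection [B^T *m (B *m v)]. *)
Lemma bessel n L p (B : 'M[R]_(n, L)) (v : 'M[R]_(L, p)) :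
  B *m B^T = 1%:M -> ip (B *m v) (B *m v) <= ip v v.
Proof.
move=> BB; have := ip_ge0 (v - B^T *m (B *m v)).
rewrite !(ipDl, ipDr, ipNl, ipNr) (ipC v) !ip_mull !trmxK.
rewrite [B *m (_ *m _)]mulmxA BB mul1mx.
by rewrite ipC ip_mull; lra.
Qed.

(* Each Householder reflection fixes one more row and changes the trace of the
   compression to the span of [B] by at most 2. *)
Lemma reflect_rows p L (X C : 'M[R]_(p, L)) k :
  X *m X^T = 1%:M -> C *m C^T = 1%:M -> (k <= p)%N ->
  exists K : 'M[R]_L, [/\ K *m K^T = 1%:M,
    forall i : 'I_p, (i < k)%N -> row i (X *m K) = row i C
  & forall n (B : 'M[R]_(n, L)), B *m B^T = 1%:M ->
      n%:R - ip (B *m K) B <= 2 * k%:R].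
Proof.
move=> XX CC; elim: k => [|k IHk] kp.
  exists 1%:M; split=> // [|n B BB]; first by rewrite trmx1 mulmx1.
  by rewrite mulmx1 /ip BB mxtrace1 subrr mulr0.
have [K [KK XK BK]] := IHk (ltnW kp); pose i0 := Ordinal kp.
pose w := row i0 (X *m K) - row i0 C.
have XKK := mulmx_orthonormal XX KK.
have HH : reflection w *m (reflection w)^T = 1%:M.
  by rewrite tr_reflection reflectionK.
exists (K *m reflection w); split.
- exact: mulmx_orthonormal.
- move=> i; rewrite ltnS leq_eqVlt mulmxA row_mul => /orP[/eqP ik|ik].
    have -> : i = i0 by apply: val_inj.
    by rewrite reflection_sub // !orthonormal_rows.
  (* A row already matched is orthogonal to both vectors whose difference is [w], so the new
     reflection fixes it. *)
  rewrite reflection_ortho ?XK // -?XK // ipDr ipNr orthonormal_rows //.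
  rewrite XK // orthonormal_rows // subrr //.
- move=> n B BB; have := BK n B BB; rewrite /reflection mulmxBr mulmx1 mulmxBr.
  rewrite -!scalemxAr ipDl ipNl ipZl !mulmxA (ip_mulr _ w).
  have h1 := bessel w^T (mulmx_orthonormal BB KK).
  have h2 := bessel w^T BB.
  have h3 := ip_ge0 (B *m K *m w^T - B *m w^T).
  have wT : ip w^T w^T = ip w w by rewrite /ip trmxK mxtrace_mulC.
  rewrite !(ipDl, ipDr, ipNl, ipNr) (ipC (B *m w^T)) in h3.
  rewrite -[k.+1%:R]natr1 mulrDr mulr1; rewrite wT in h1 h2.
  set x := ip (B *m K *m w^T) (B *m w^T) in h3 *.
  (* This is the loss of trace. Bessel bounds both factors of [x] by the norm of [w], so
     [x <= ip w w]; for [w = 0] the quotient is 0. *)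
  have : 2 / ip w w * x <= 2.
    have [->|w0] := eqVneq w 0; first by rewrite ip0l invr0 mulr0 mul0r.
    by rewrite mulrAC ler_pdivrMr ?ip_gt0 //; lra.
  lra.
Qed.

(** A bathtub argument: a total weight [2 * r] capped at 2 per index is best spent on the first [r]
    indices, because [(s j - c) * (u j - 2 * (j < r)%:R) <= 0] for every [j]. *)
Lemma sum_weights_le n r (s u : 'I_n -> R) (c : R) : (r <= n)%N -> 0 <= c ->
  (forall j : 'I_n, (j < r)%N -> c <= s j) ->
  (forall j : 'I_n, (r <= j)%N -> s j <= c) ->
  (forall j, 0 <= u j <= 2) -> \sum_j u j <= 2 * r%:R ->
  \sum_j s j * u j <= 2 * \sum_(j < n | (j < r)%N) s j.
Proof.
move=> rn c0 sl sr u02 ur.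
have -> : \sum_(j < n | (j < r)%N) s j = \sum_(j < n) (j < r)%:R * s j.
  rewrite big_mkcond; apply: eq_bigr => j _.
  by case: (j < r)%N; rewrite ?mul1r ?mul0r.
have rE : r%:R = \sum_(j < n) (j < r)%:R :> R.
  rewrite -{1}(card_ord r) -sumr_const (big_ord_widen n (fun=> 1) rn).
  by rewrite big_mkcond; apply: eq_bigr => j _; case: ltnP.
rewrite -subr_le0 mulr_sumr -sumrB.
apply: (@le_trans _ _ (\sum_(j < n) c * (u j - 2 * (j < r)%:R))).
  apply: ler_sum => j _; have /andP[u0 u2] := u02 j.
  have [jr|jr] := ltnP; first by have := sl j jr; rewrite mul1r mulr1; nra.
  by have := sr j jr; rewrite mul0r !mulr0 !subr0; nra.
by rewrite -mulr_sumr sumrB -mulr_sumr -rE mulr_ge0_le0 // subr_le0.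
Qed.

Lemma nuclear_norm_add_ge n N r (A M : 'M[R]_(n, N)) :
  (1 <= r <= n)%N -> (\rank A <= r)%N ->
  nuclear_norm A + (\sum_(r.+1 <= j < n.+1) sigma M j -
                    \sum_(1 <= j < r.+1) sigma M j) <= nuclear_norm (A + M).
Proof.
move=> /andP[r0 rn] rA.
have [V [C [VV CC AE]]] := padded_svd A.
have [U [B [UU BB ME]]] := padded_svd M.
have UtU : U^T *m U^T^T = 1%:M by rewrite trmxK (mulmx1C UU).
have Y0 := mulmx_orthonormal UtU BB.
(* [U^T *m B] is a polar factor of the padded [M]; after [K], the first [r] rows of [V *m Y] are
   right singular vectors of [A]. The other rows are harmless, as [sigma A] vanishes there. *)
have [K [KK VK BK]] := reflect_rows (mulmx_orthonormal VV Y0) CC rn.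
pose Y := U^T *m B *m K.
have YY : Y *m Y^T = 1%:M by apply: mulmx_orthonormal.
apply: le_trans (ip_le_nuclear_norm (A + M) YY).
rewrite -[X in row_mx _ X]addr0 -add_row_mx ipDr lerD //.
  rewrite AE ip_svd nuclear_normE; apply: ler_sum => j _; rewrite mxE.
  have [jr|jr] := ltnP j r; last first.
    by rewrite sigma_gt_rank ?mul0r // (leq_trans rA).
  by rewrite -ip_row /Y mulmxA VK // orthonormal_rows // eqxx mulr1.
rewrite ME ip_svd /Y !mulmxA UU mul1mx.
pose u j := 1 - (B *m K *m B^T) j j.
have BKK := mulmx_orthonormal BB KK.
have hu j : 0 <= u j <= 2.
  have := orthonormal_ip_le1 j BKK BB; rewrite ler_norml /u => /andP[h1 h2].
  by apply/andP; split; lra.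
have su : \sum_j u j <= 2 * r%:R.
  by have := BK _ _ BB; rewrite sumrB sumr_const card_ord.
have rn' : (r.-1 < n)%N by rewrite prednK.
(* The threshold is [sigma M r], found at the zero-based index [r.-1]. *)
have := @sum_weights_le n r (fun j => sigma M j.+1) u _ rn
  (sigma_ge0 M (Ordinal rn').+1) _ _ hu su.
rewrite -head_sumE // => W.
have {}W : \sum_(j < n) sigma M j.+1 * u j <= 2 * \sum_(1 <= j < r.+1) sigma M j.
  apply: W => j jr; apply: sigma_le => /=; first by rewrite -ltnS prednK.
  exact: leq_trans (leq_pred r) jr.
have -> : \sum_(j < n) (\row_(j < n) sigma M j.+1) 0 j * (B *m K *m B^T) j j =
          nuclear_norm M - \sum_(j < n) sigma M j.+1 * u j.
  rewrite nuclear_normE -sumrB; apply: eq_bigr => j _; rewrite mxE /u; ring.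
have := nuclear_norm_split M rn; lra.
Qed.

End NuclearNorm.

(** * Unique recovery from the null space property *)

Theorem theorem2p14 (R : realType) (n N m r : nat)
    (hr : (1 <= r <= n)%N)
    (X : {linear 'M[R]_(n, N) -> 'cV[R]_m})
    (hX : exists2 delta : R, has_RIP X (2 * r) delta & delta < 1 / 3) :
  has_NSP X r /\
  (forall A : 'M[R]_(n, N), (\rank A <= r)%N ->
     is_unique_minimizer (@nuclear_norm R n N)
       (fun Z : 'M[R]_(n, N) => X Z = X A) A).
Proof.
have [delta rip d3] := hX; have nsp := RIP_NSP hr rip d3; split=> // A rA.
(* [Z - A] is a nonzero kernel element, so the null space property makes the gain over [A] positive.
   This strict inequality gives both minimality and uniqueness. *)
have lt Z : X Z = X A -> Z != A -> nuclear_norm A < nuclear_norm Z.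
  move=> XZ ZA; have := nuclear_norm_add_ge (Z - A) hr rA.
  rewrite [A + _]addrC subrK.
  apply: lt_le_trans; rewrite ltrDl subr_gt0; apply: nsp; rewrite ?subr_eq0 //.
  by rewrite linearB /= XZ subrr.
split=> [|Z [XZ minZ]].
  by split=> // Z XZ; have [->|/(lt _ XZ)/ltW] := eqVneq Z A.
by apply/eqP; apply: contraT => /(lt _ XZ); rewrite ltNge minZ.
Qed.
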